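(* Let $P$ be a poset. There are monoids $M<N$ such that $P\cong P(N,M)$ if and only if there is a submonoid $L<\mathrm{End}(P)$ and a principal upset $\uparrow\! e\subseteq P$ such that for every element $x\in P$ there is a unique $\varphi_x\in L$ such that $\varphi_x(\uparrow\! e)=\,\uparrow\! x$. Moreover, in this case $\uparrow\! e=M$ and $L=L(N)\cong N$.
   Context: For monoids, $M<N$ means that $M$ is a submonoid of $N$ (with the same neutral element; equality $M=N$ is allowed). On $N$ define $x\leq_M y :\iff \exists m\in M:\ xm=y$. The notation $P(N,M)$ is used only when $\leq_M$ is an order relation on $N$, and then denotes the poset $(N,\leq_M)$. $\mathrm{End}(P)$ is the monoid of order endomorphisms (order-preserving self-maps) of $P$ under composition; its submonoids contain the identity map. For $x\in P$, $\uparrow\! x=\{y\in P\mid x\leq y\}$ is the principal upset of $x$. $L(N)=\{\varphi_n\mid n\in N\}$, where $\varphi_n:N\to N$, $\varphi_n(x)=nx$, is left-multiplication by $n$.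
   Formalization: The submonoid L is additionally required to consist only of the maps φ_x (every element of L sends ↑e onto some principal upset); if L may contain further endomorphisms, both the ''if'' direction and L = L(N) can fail. *)

(* Defs.v *)
From HB Require Import structures.
From Corelib Require Relation_Definitions.
From mathcomp Require Import all_boot all_order.
From mathcomp Require Import boolp classical_sets functions.

Set Implicit Arguments.
Unset Strict Implicit.
Unset Printing Implicit Defensive.

Import Order.TTheory.

Local Open Scope classical_set_scope.
Local Open Scope group_scope.

Definition submonoid (N : monoidType) (M : set N) : Prop := monoid_closed [in M].

Definition leM (N : monoidType) (M : set N) (x y : N) : Prop :=
  exists2 m, M m & x * m = y.

(* The standing assumption under which P(N,M) denotes a poset. *)
Definition cayley_poset (N : monoidType) (M : set N) : Prop :=
  submonoid M /\ Relation_Definitions.order N (leM M).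

Definition cayley_iso (d : Order.disp_t) (P : porderType d) (N : monoidType)
    (M : set N) (f : P -> N) : Prop :=
  bijective f /\ forall x y : P, (x <= y)%O <-> leM M (f x) (f y).

Definition upset (d : Order.disp_t) (P : porderType d) (x : P) : set P :=
  [set y | (x <= y)%O].

(* The monoid End(P); the product is composition, (f * g) x = f (g x). *)
Definition orderEnd (d : Order.disp_t) (P : porderType d) : Type :=
  {omorphism P -> P}.

Section OrderEndMonoid.
Variables (d : Order.disp_t) (P : porderType d).

Definition orderEnd_fun (f : orderEnd P) : P -> P :=
  fun x => (f : {omorphism P -> P}) x.

Definition orderEnd_id : orderEnd P := (idfun : P -> P) : {omorphism P -> P}.

Definition orderEnd_comp (f g : orderEnd P) : orderEnd P :=
  ((f : {omorphism P -> P}) \o (g : {omorphism P -> P})) : {omorphism P -> P}.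

Lemma orderEnd_ext (f g : orderEnd P) : orderEnd_fun f =1 orderEnd_fun g -> f = g.
Proof.
case: f g => [f [[hf]]] [g [[hg]]] fg.
have {}fg : f = g by apply: funext => x; exact: fg.
by subst g; rewrite (Prop_irrelevance hf hg).
Qed.

Fact orderEnd_compA : associative orderEnd_comp.
Proof. by move=> f g h; apply: orderEnd_ext. Qed.

Fact orderEnd_comp1f : left_id orderEnd_id orderEnd_comp.
Proof. by move=> f; apply: orderEnd_ext. Qed.

Fact orderEnd_compf1 : right_id orderEnd_id orderEnd_comp.
Proof. by move=> f; apply: orderEnd_ext. Qed.

HB.instance Definition _ := gen_eqMixin (orderEnd P).
HB.instance Definition _ := gen_choiceMixin (orderEnd P).
HB.instance Definition _ := isMonoid.Build (orderEnd P)
  orderEnd_compA orderEnd_comp1f orderEnd_compf1.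

End OrderEndMonoid.

Coercion orderEnd_fun : orderEnd >-> Funclass.
Arguments orderEnd_fun : simpl never.

(* The last clause says that L is exactly the family of the phi_x.  Without it
   L may contain further endomorphisms and L = L(N) fails: on the natural
   numbers take e = 0 and for L all the maps x |-> 2^k x + b. *)
Definition upset_transitive (d : Order.disp_t) (P : porderType d)
    (L : set (orderEnd P)) (e : P) : Prop :=
  [/\ submonoid L,
      forall x : P, exists! phi : orderEnd P,
        L phi /\ phi @` upset e = upset x &
      forall phi : orderEnd P, L phi ->
        exists x : P, phi @` upset e = upset x].

(* L(N) *)
Definition left_mults (N : monoidType) : set (N -> N) :=
  range (fun n x : N => n * x).
Arguments left_mults : clear implicits.

(* For f bijective, the set of all f \o phi \o f^-1 with phi in L. *)
Definition transport_along (d : Order.disp_t) (P : porderType d) (N : Type)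
    (f : P -> N) (L : set (orderEnd P)) : set (N -> N) :=
  [set psi : N -> N | exists2 phi : orderEnd P, L phi & psi \o f = f \o phi].

Definition submonoid_isog (N : monoidType) (d : Order.disp_t)
    (P : porderType d) (L : set (orderEnd P)) : Prop :=
  exists h : N -> orderEnd P, monoid_morphism h /\ set_bij [set: N] L h.

(* "The upset of e is M and L = L(N) is isomorphic to N", where P and N are
   identified along the isomorphism f. *)
Definition upset_matches (d : Order.disp_t) (P : porderType d)
    (N : monoidType) (M : set N) (f : P -> N)
    (L : set (orderEnd P)) (e : P) : Prop :=
  [/\ f @` upset e = M,
      transport_along f L = left_mults N &
      submonoid_isog N L].

(* Main.v *)
Require Import Defs.
From HB Require Import structures.
From mathcomp Require Import all_boot all_order.
From mathcomp Require Import boolp classical_sets functions.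

(** If [P = P(N, M)], left multiplications are order endomorphisms of [P], and
    [n (1 M) = n M] says that left multiplication by [n] maps the upset of [1]
    onto the upset of [n].  A poset element is determined by its upset, so [n]
    is the only element of [N] that does so: [L(N)] has the required property
    for [e = 1].

    Conversely, an endomorphism mapping the upset of [e] onto the upset of [x]
    maps the minimum [e] to the minimum [x] ([image_upset_min]).  Hence
    evaluation at [e] is a bijection from [L] onto [P], with inverse
    [x |-> phi_x] ([upset_map]).  Transporting composition along it makes [P] a
    monoid with product [x * y = phi_x y] and unit [e] ([upset_monoid]), in
    which left multiplication by [x] is [phi_x] itself.  For [M] the upset of
    [e], the relation [x M = phi_x (upset e) = upset x] says that the order of
    [P(N, M)] is that of [P]. *)

Section Upsets.
Set Implicit Arguments.
Unset Strict Implicit.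
Import Order.TTheory.
Local Open Scope classical_set_scope.
Local Open Scope order_scope.
Context {d : Order.disp_t} {P : porderType d}.
Implicit Types (x y : P) (phi : orderEnd P).

Lemma upset_refl x : upset x x.
Proof. exact: lexx. Qed.

Lemma upset_inj : injective (@upset d P).
Proof.
move=> x y xy; apply/le_anti/andP; split.
- by have := upset_refl y; rewrite -xy.
- by have := upset_refl x; rewrite xy.
Qed.

Lemma orderEnd_le phi x y : x <= y -> phi x <= phi y.
Proof. exact: (@omorph_le _ _ _ _ (phi : {omorphism P -> P})). Qed.

Lemma image_upset_min phi e x : phi @` upset e = upset x -> phi e = x.
Proof.
move=> phiE; apply/le_anti/andP; split.
- by have := upset_refl x; rewrite -phiE => -[y ey <-]; exact: orderEnd_le.
- have: (phi @` upset e) (phi e) by exists e => //; exact: upset_refl.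
  by rewrite phiE.
Qed.

End Upsets.

Section PosetOfMonoid.
Set Implicit Arguments.
Unset Strict Implicit.
Local Open Scope classical_set_scope.
Local Open Scope group_scope.
Variables (d : Order.disp_t) (P : porderType d) (N : monoidType) (M : set N).
Variables (f : P -> N) (g : N -> P).
Hypotheses (fK : cancel f g) (gK : cancel g f).
Hypothesis f_le : forall x y : P, (x <= y)%O <-> leM M (f x) (f y).

Lemma upset_leM n y : upset (g n) y <-> leM M n (f y).
Proof. by rewrite /upset /= f_le gK. Qed.

(** Left multiplication by [n] on [N], carried over to [P] along the bijection
    [f], with inverse [g]. *)
Definition left_mult (n : N) : P -> P := fun x => g (n * f x).

Lemma left_mult_le n : {homo left_mult n : x y / (x <= y)%O}.
Proof.
move=> x y /f_le[m Mm xm]; apply/f_le; rewrite /left_mult !gK.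
by exists m => //; rewrite -mulgA xm.
Qed.

HB.instance Definition _ n :=
  Order.isOrderMorphism.Build d P d P (left_mult n) (left_mult_le n).

Definition left_mult_end (n : N) : orderEnd P :=
  (left_mult n : {omorphism P -> P}).

Lemma left_mult_endE n x : left_mult_end n x = g (n * f x).
Proof. by []. Qed.

Lemma left_mult_upset n : left_mult_end n @` upset (g 1) = upset (g n).
Proof.
apply/seteqP; split=> y.
- move=> [x /upset_leM[m Mm xm] <-]; apply/upset_leM.
  by exists m; rewrite // left_mult_endE gK -xm mul1g.
- move=> /upset_leM[m Mm nm]; exists (g m).
    by apply/upset_leM; exists m; rewrite ?gK ?mul1g.
  by rewrite left_mult_endE gK nm fK.
Qed.

Lemma left_mult_end_morphism : monoid_morphism left_mult_end.
Proof.
split=> [|m n]; apply: orderEnd_ext => x.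
- by rewrite left_mult_endE mul1g fK.
- rewrite -[RHS]/(left_mult_end m (left_mult_end n x)).
  by rewrite !left_mult_endE gK mulgA.
Qed.

Lemma left_mult_end_inj : injective left_mult_end.
Proof.
move=> m n /(congr1 (fun phi : orderEnd P => f (phi (g 1)))).
by rewrite !left_mult_endE !gK !mulg1.
Qed.

Lemma left_mult_transitive : upset_transitive (range left_mult_end) (g 1).
Proof.
split.
- have [h1 hM] := left_mult_end_morphism; split.
    by rewrite inE; exists 1; rewrite ?h1.
  move=> u v; rewrite !inE => -[m _ <-] [n _ <-].
  by exists (m * n); rewrite ?hM.
- move=> x; exists (left_mult_end (f x)); split.
    by split; [exists (f x) | rewrite left_mult_upset fK].
  move=> _ [[n _ <-]]; rewrite left_mult_upset => /upset_inj <-.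
  by rewrite gK.
- by move=> _ [n _ <-]; exists (g n); exact: left_mult_upset.
Qed.

Lemma left_mult_matches : upset_matches M f (range left_mult_end) (g 1).
Proof.
split.
- apply/seteqP; split=> n.
  + by move=> [x /upset_leM[m Mm <-] <-]; rewrite mul1g.
  + move=> Mn; exists (g n); last exact: gK.
    by apply/upset_leM; exists n; rewrite ?gK ?mul1g.
- apply/seteqP; split=> psi.
  + move=> [_ [n _ <-] psiE]; exists n => //; apply: funext => x.
    rewrite -[x in RHS]gK -[RHS]/((psi \o f) (g x)) psiE /=.
    by rewrite left_mult_endE !gK.
  + move=> [n _ <-]; exists (left_mult_end n); first by exists n.
    by apply: funext => x; rewrite /= left_mult_endE gK.
- exists left_mult_end; split; first exact: left_mult_end_morphism.
  split=> [n _|m n _ _|_ [n _ <-]]; [by exists n| |by exists n].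
  exact: left_mult_end_inj.
Qed.

End PosetOfMonoid.

Section MonoidOfPoset.
Set Implicit Arguments.
Unset Strict Implicit.
Import Order.TTheory.
Local Open Scope classical_set_scope.
Local Open Scope group_scope.
Variables (d : Order.disp_t) (P : porderType d).
Variables (L : set (orderEnd P)) (e : P).
Hypothesis Le : upset_transitive L e.
Implicit Types (x y z : P) (phi : orderEnd P).

Let LP x : exists phi, L phi /\ phi @` upset e = upset x.
Proof. by have [_ /(_ x)[phi [phiP _]] _] := Le; exists phi. Qed.

(** The unique element [phi_x] of [L] mapping the upset of [e] onto that of
    [x]. *)
Definition upset_map x : orderEnd P := projT1 (cid (LP x)).

Lemma upset_map_in x : L (upset_map x).
Proof. by rewrite /upset_map; case: cid => phi []. Qed.

Lemma image_upset_map x : upset_map x @` upset e = upset x.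
Proof. by rewrite /upset_map; case: cid => phi []. Qed.

Lemma upset_map_e x : upset_map x e = x.
Proof. exact: image_upset_min (image_upset_map x). Qed.

Lemma upset_mapK phi : L phi -> upset_map (phi e) = phi.
Proof.
have [_ Luniq Lsurj] := Le => Lphi; have [x phiE] := Lsurj _ Lphi.
have [psi [_ psi_uniq]] := Luniq x; rewrite (image_upset_min phiE).
rewrite -(psi_uniq phi) // (psi_uniq (upset_map x)) //; split.
- exact: upset_map_in.
- exact: image_upset_map.
Qed.

Lemma upset_map1 : upset_map e = 1.
Proof.
have [[L1 _] _ _] := Le; rewrite inE in L1.
exact: (upset_mapK L1).
Qed.

Lemma upset_map_mul x y : upset_map (upset_map x y) = upset_map x * upset_map y.
Proof.
have [[_ LM] _ _] := Le.
have Lxy : L (upset_map x * upset_map y).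
  by apply: set_mem; apply: LM; apply: mem_set; exact: upset_map_in.
rewrite -[RHS](upset_mapK Lxy); congr upset_map.
by rewrite -[RHS]/(upset_map x (upset_map y e)) upset_map_e.
Qed.

Fact upset_mulA : associative (fun x y => upset_map x y).
Proof. by move=> x y z; rewrite upset_map_mul. Qed.

Fact upset_mul1 : left_id e (fun x y => upset_map x y).
Proof. by move=> x; rewrite upset_map1. Qed.

(** The poset [P] as a monoid, with product [x * y = phi_x y] and unit [e]. *)
Definition upset_monoid : monoidType :=
  HB.pack_for monoidType (P : Type)
    (Choice.on P)
    (@isMonoid.Build P _ e upset_mulA upset_mul1 upset_map_e).

Let M : set upset_monoid := upset e.

Lemma leM_upset x y : (x <= y)%O <-> leM M x y.
Proof.
change (upset x y <-> leM M x y); rewrite -image_upset_map.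
by split=> [[m em <-]|[m em <-]]; exists m.
Qed.

Lemma upset_cayley : cayley_poset M.
Proof.
split; split.
- by rewrite inE; exact: lexx.
- move=> x y; rewrite !inE => ex ey.
  apply: (le_trans ex); rewrite -[X in (X <= _)%O]upset_map_e.
  exact: orderEnd_le.
- by move=> x; apply/leM_upset; exact: lexx.
- move=> x y z /leM_upset xy /leM_upset yz.
  by apply/leM_upset; exact: le_trans yz.
- move=> x y /leM_upset xy /leM_upset yx.
  by apply/le_anti/andP; split.
Qed.

Lemma upset_cayley_iso : cayley_iso (N := upset_monoid) M (id : P -> P).
Proof. by split; [exists id | exact: leM_upset]. Qed.

Lemma upset_monoid_matches :
  upset_matches (N := upset_monoid) M (id : P -> P) L e.
Proof.
split.
- exact: image_id.
- apply/seteqP; split=> psi.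
  + move=> [phi Lphi psiE]; exists (phi e) => //; apply: funext => x.
    rewrite -[LHS]/(upset_map (phi e) x) upset_mapK //.
    by rewrite -[LHS]/((id \o phi) x) -psiE.
  + move=> [n _ <-]; exists (upset_map n) => //; exact: upset_map_in.
- exists upset_map; split.
    by split; [exact: upset_map1 | exact: upset_map_mul].
  split=> [x _|x y _ _ xy|phi Lphi].
  + exact: upset_map_in.
  + by rewrite -[x]upset_map_e xy upset_map_e.
  + by exists (phi e) => //; exact: upset_mapK.
Qed.

End MonoidOfPoset.

Theorem theorem2p6 (d : Order.disp_t) (P : porderType d) :
  [/\ (exists (N : monoidType) (M : set N), cayley_poset M /\
         exists f : P -> N, cayley_iso M f)
      <->
      (exists (L : set (orderEnd P)) (e : P), upset_transitive L e),

      (forall (N : monoidType) (M : set N) (f : P -> N),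
         cayley_poset M -> cayley_iso M f ->
         exists (L : set (orderEnd P)) (e : P),
           upset_transitive L e /\ upset_matches M f L e)
    & (forall (L : set (orderEnd P)) (e : P),
         upset_transitive L e ->
         exists (N : monoidType) (M : set N) (f : P -> N),
           [/\ cayley_poset M, cayley_iso M f & upset_matches M f L e])].
Proof.
have to_L (N : monoidType) (M : set N) (f : P -> N) :
    cayley_poset M -> cayley_iso M f ->
    exists (L : set (orderEnd P)) (e : P),
      upset_transitive L e /\ upset_matches M f L e.
  move=> _ [[g fK gK] f_le].
  exists (range (left_mult_end gK f_le)), (g 1%g); split.
  - exact: left_mult_transitive.
  - exact: left_mult_matches.
have to_N (L : set (orderEnd P)) (e : P) :
    upset_transitive L e ->
    exists (N : monoidType) (M : set N) (f : P -> N),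
      [/\ cayley_poset M, cayley_iso M f & upset_matches M f L e].
  move=> Le; exists (upset_monoid Le), (upset e), id; split.
  - exact: upset_cayley.
  - exact: upset_cayley_iso.
  - exact: upset_monoid_matches.
split=> //; split.
- move=> [N [M [MP [f fP]]]]; have [L [e [Le _]]] := to_L _ _ _ MP fP.
  by exists L, e.
- move=> [L [e Le]]; have [N [M [f [MP fP _]]]] := to_N _ _ Le.
  by exists N, M; split=> //; exists f.
Qed.
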